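(* Let $G$ be a connected semigraph with $n$ vertices and $m$ edges $e_1,\dots,e_m$, where $r_i$ is the number of vertices of $e_i$, and let $m_2$ be the number of quarter edges, $m_3$ the number of half edges with exactly one partial half edge, and $m_4$ the number of half edges with two partial half edges. Let $\lambda_1$ be the largest eigenvalue of the adjacency matrix of $G$. Then $$\mathcal{E}(G)\leq \lambda_1+\sqrt{(n-1)\left(\frac{1}{6}\sum_{i=1}^{m}r_i^2(r_i^2-1)-\frac{15}{8}m_2-\frac{3}{4}m_3-\frac{1}{2}m_4-\lambda_1^2\right)}.$$
   Context: A semigraph $G=(V,E)$ has a finite vertex set $V=\{v_1,\dots,v_n\}$, $n\ge2$, and edges that are ordered tuples $(u_1,\dots,u_k)$, $k\ge2$, of distinct vertices, with any two edges sharing at most one vertex, and $(u_1,\dots,u_k)$ identified with $(u_k,\dots,u_1)$. In an edge $(u_1,\dots,u_k)$, $u_1,u_k$ are end vertices and $u_2,\dots,u_{k-1}$ middle vertices. A vertex is a pure end vertex if it is an end vertex of every edge containing it, and a middle end vertex if it is a middle vertex of at least one edge and an end vertex of at least one other edge. An edge $(u_1,\dots,u_k)$ is full if $u_1,u_k$ are pure end vertices; an edge with $k>2$ is a half edge if $u_1$ or $u_k$ is a middle end vertex; an edge $(u_1,u_2)$ is a quarter edge if both $u_1,u_2$ are middle end vertices, and a half edge if exactly one is a middle end vertex. In a half edge $(u_1,\dots,u_k)$, $(u_1,u_2)$ is a partial half edge if $u_1$ is a middle end vertex, and $(u_{k-1},u_k)$ is a partial half edge if $u_k$ is a middle end vertex.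 $G$ is connected if any two vertices $u,v$ are joined by a sequence of edges $e_{1},\dots,e_{p}$ with $u\in e_1$, $v\in e_p$ and $|e_j\cap e_{j+1}|=1$. For $u_i,u_j$ in an edge $e=(u_1,\dots,u_k)$, $d_e(u_i,u_j)=|i-j|$. The adjacency matrix $A=(a_{ij})$ is indexed by vertices: $a_{ij}=d_e(v_i,v_j)$ if $v_i,v_j$ lie in a common full or half edge $e$ and $(v_i,v_j)$ is neither a partial half edge nor a quarter edge; $a_{ij}=\frac12$ if $(v_i,v_j)$ is a partial half edge; $a_{ij}=\frac14$ if $(v_i,v_j)$ is a quarter edge; $a_{ij}=0$ otherwise. $A$ is symmetric, so its eigenvalues are real; the energy $\mathcal{E}(G)$ is the sum of the absolute values of the eigenvalues of $A$. *)

(* Defs.v *)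
From HB Require Import structures.
From mathcomp Require Import all_boot all_order all_algebra.
From mathcomp Require Import polyrcf.

Set Implicit Arguments.
Unset Strict Implicit.
Unset Printing Implicit Defensive.

Import Order.TTheory GRing.Theory Num.Theory.

(* Vertices are 'I_n and edges are indexed by 'I_m.  Each edge is given by one
   of its two orderings; every notion below is invariant under reversal.  Edges
   have at least two vertices, so [edge_meet] also makes distinct indices denote
   distinct edges, even up to reversal. *)
Record semigraph (n m : nat) := Semigraph {
  edge :> 'I_m -> seq 'I_n;
  order_gt1 : 1 < n;
  edge_size : forall e, 1 < size (edge e);
  edge_uniq : forall e, uniq (edge e);
  edge_meet : forall e f, e != f ->
    #|[set v in edge e] :&: [set v in edge f]| <= 1
}.

Section Semigraph.
Variables (n m : nat) (G : semigraph n m).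
Implicit Types (e f : 'I_m) (u v : 'I_n).

(* For v in e = (u_1, ..., u_k), [pos e v] is the i with v = u_(i+1). *)
Definition pos e v : nat := index v (G e).

Definition end_vertex e v : bool :=
  (v \in G e) && ((pos e v == 0) || (pos e v == (size (G e)).-1)).

Definition middle_vertex e v : bool :=
  (v \in G e) && (0 < pos e v < (size (G e)).-1).

Definition pure_end_vertex v : bool :=
  [forall e, (v \in G e) ==> end_vertex e v].

Definition middle_end_vertex v : bool :=
  [exists e, exists f, [&& e != f, middle_vertex e v & end_vertex f v]].

Definition full_edge e : bool :=
  [forall v, end_vertex e v ==> pure_end_vertex v].

Definition quarter_edge e : bool :=
  (size (G e) == 2) && [forall v, end_vertex e v ==> middle_end_vertex v].

Definition half_edge e : bool :=
  (2 < size (G e)) && [exists v, end_vertex e v && middle_end_vertex v]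
  || (size (G e) == 2)
     && (#|[set v | end_vertex e v & middle_end_vertex v]| == 1).

(* The pair (u, v) is listed in the order of the edge: it is (u_1, u_2) or
   (u_(k-1), u_k).  For k = 2 these two are the same pair. *)
Definition partial_half_edge e u v : bool :=
  [&& half_edge e, u \in G e, v \in G e &
    [&& pos e u == 0, pos e v == 1 & middle_end_vertex u]
    || [&& pos e u == (size (G e)).-2, pos e v == (size (G e)).-1
         & middle_end_vertex v]].

Definition num_partial_half_edges e : nat :=
  #|[set p : 'I_n * 'I_n | partial_half_edge e p.1 p.2]|.

Definition num_quarter_edges : nat := #|[set e | quarter_edge e]|.

Definition num_half_edges_with (k : nat) : nat :=
  #|[set e | half_edge e & num_partial_half_edges e == k]|.

Definition edge_adjacent e f : bool :=
  #|[set v in G e] :&: [set v in G f]| == 1.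

Definition semigraph_connected : Prop :=
  forall u v, exists e (s : seq 'I_m),
    [/\ u \in G e, v \in G (last e s) & path edge_adjacent e s].

Definition edge_dist e u v : nat := `|pos e u - pos e v|%N.

(* At most one edge contains two given distinct vertices, so the choice made by
   [pick] only matters when u = v, where every choice gives 0. *)
Definition adjacency (R : rcfType) : 'M[R]_n :=
  \matrix_(u, v)
    (if [exists e, partial_half_edge e u v || partial_half_edge e v u]
     then 1 / 2
     else if [exists e, [&& quarter_edge e, u != v, u \in G e & v \in G e]]
     then 1 / 4
     else if [pick e | [&& full_edge e || half_edge e, u \in G e & v \in G e]]
       is Some e then (edge_dist e u v)%:R
     else 0)%R.

End Semigraph.

Local Open Scope ring_scope.

(* The eigenvalues lying in R, repeated according to their multiplicity as roots
   of the characteristic polynomial; for a symmetric matrix these are all n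
   eigenvalues. *)
Definition eigenvalues (R : rcfType) (n : nat) (A : 'M[R]_n) : seq R :=
  flatten [seq nseq (mup x (char_poly A)) x | x <- rootsR (char_poly A)].

Definition energy (R : rcfType) (n m : nat) (G : semigraph n m) : R :=
  \sum_(x <- eigenvalues (adjacency G R)) `|x|.

Definition largest_eigenvalue (R : rcfType) (n : nat) (A : 'M[R]_n) (l : R) :=
  eigenvalue A l /\ forall x, eigenvalue A x -> x <= l.

(* Main.v *)
(** Koolen-Moulton argument.  The adjacency matrix A is real symmetric with zero
    trace, so its characteristic polynomial splits over R and its largest
    eigenvalue is nonnegative; Cauchy-Schwarz applied to the n - 1 other
    eigenvalues gives the bound with tr(A^2) in place of the edge expression.
    An edge with r vertices would contribute r^2(r^2-1)/6 to tr(A^2) if all its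
    entries were distances; a quarter edge removes 2(1 - 1/16) = 15/8 from this,
    and each partial half edge removes 2(1 - 1/4) = 3/2, which is more than the
    3/4 for m_3 and the 1/2 for m_4 claimed in the statement.  Hence the edge
    expression only dominates tr(A^2), which suffices. *)

Require Import Defs.
From mathcomp Require Import all_boot all_order all_algebra.
From mathcomp Require Import reals complex polyrcf spectral sesquilinear.
From mathcomp Require Import ring lra.
Set Implicit Arguments.
Unset Strict Implicit.
Unset Printing Implicit Defensive.

Import Order.TTheory GRing.Theory Num.Theory.
Local Open Scope ring_scope.

(** * Spectrum of a real symmetric matrix *)

Lemma char_poly_conj (F : fieldType) n (P A : 'M[F]_n) :
  P \in unitmx -> char_poly (invmx P *m A *m P) = char_poly A.
Proof.
move=> uP; rewrite /char_poly /char_poly_mx.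
have PV : map_mx polyC (invmx P) *m map_mx polyC P = 1%:M.
  by rewrite -map_mxM mulVmx // map_mx1.
have -> : 'X%:M - map_mx polyC (invmx P *m A *m P) =
    map_mx polyC (invmx P) *m ('X%:M - map_mx polyC A) *m map_mx polyC P.
  by rewrite mulmxBr mulmxBl !map_mxM scalar_mxC -(mulmxA 'X%:M) PV mulmx1.
by rewrite !det_mulmx mulrAC -det_mulmx PV det1 mul1r.
Qed.

(** Over [R[i]] the matrix becomes hermitian, hence unitarily diagonalizable with a real diagonal.
    Characteristic polynomial and trace are invariant under conjugation, and injectivity of [toC]
    brings the identities back to [R]. *)
Lemma symmetric_spectrum (R : rcfType) n (A : 'M[R]_n) : A^T = A ->
  exists r : 'I_n -> R,
    [/\ char_poly A = \prod_i ('X - (r i)%:P), \tr A = \sum_i r i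
      & \tr (A *m A) = \sum_i r i ^+ 2].
Proof.
move=> symA; pose toC : {rmorphism R -> R[i]} := real_complex R.
pose AC := map_mx toC A.
have herm : AC \is hermsymmx.
  apply: realsym_hermsym.
    apply/is_hermitianmxP; rewrite expr0 scale1r map_mx_id // /AC map_trmx.
    by rewrite symA.
  by apply/mxOverP => i j; rewrite mxE; apply/complex_realP; exists (A i j).
have /orthomx_spectralP := hermitian_normalmx herm.
have := hermitian_spectral_diag_real herm => /mxOverP dreal.
set P := spectralmx AC; set d := spectral_diag AC => ACE.
have uP : P \in unitmx := spectral_unit AC.
pose r i := complex.Re (d 0 i).
have dE : d = map_mx toC (\row_i r i).
  by apply/rowP => i; rewrite !mxE /toC /= RRe_real.
have trE B : \tr (invmx P *m B *m P) = \tr B.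
  by rewrite -mulmxA mxtrace_mulC -mulmxA mulmxV // mulmx1.
have toCI := fmorph_inj toC.
exists r; split.
- apply: (map_poly_inj toC); rewrite map_char_poly -/AC ACE char_poly_conj //.
  rewrite char_poly_trig ?diag_mx_is_trig // rmorph_prod.
  apply: eq_bigr => i _; rewrite rmorphB /= map_polyX map_polyC.
  by rewrite !mxE eqxx mulr1n dE !mxE.
- apply: toCI; rewrite -trace_map_mx -/AC ACE trE mxtrace_diag rmorph_sum.
  by apply: eq_bigr => i _; rewrite dE !mxE.
apply: toCI; rewrite -trace_map_mx map_mxM -/AC ACE.
have -> : invmx P *m diag_mx d *m P *m (invmx P *m diag_mx d *m P) =
          invmx P *m (diag_mx d *m diag_mx d) *m P.
  by rewrite !mulmxA mulmxK.
rewrite trE mulmx_diag mxtrace_diag rmorph_sum.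
by apply: eq_bigr => i _; rewrite dE !mxE expr2 rmorphM.
Qed.

(** Both lists contain each [x] as often as its multiplicity as a root. *)
Lemma perm_eigenvalues (R : rcfType) n (A : 'M[R]_n) (s : seq R) :
  char_poly A = \prod_(x <- s) ('X - x%:P) -> perm_eq (eigenvalues A) s.
Proof.
move=> cpE; have p0 : char_poly A != 0 by rewrite monic_neq0 ?char_poly_monic.
apply/allP => x _ /=; apply/eqP.
have -> : count_mem x s = mup x (char_poly A).
  rewrite cpE; elim: s {cpE p0} => [|y s IHs] /=.
    by rewrite big_nil mupNroot // root1.
  rewrite big_cons mupM ?polyXsubC_eq0 ?IHs //.
    by rewrite -['X - y%:P]expr1 mup_XsubCX; case: eqP.
  by rewrite monic_neq0 // monic_prod_XsubC.
rewrite /eigenvalues count_flatten -map_comp.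
(* Only the block of [x] itself contributes to its count, and [rootsR] has no repetitions. *)
rewrite (eq_map (g := fun y => (y == x) * mup x (char_poly A))%N); last first.
  by move=> y /=; rewrite count_nseq /=; case: eqP => [->|].
rewrite sumnE big_map -big_distrl /=.
rewrite -(big_map (fun y => (y == x) : nat) xpredT id) -sumnE sumn_count.
have := roots_on_rootsR p0 x; rewrite in_itv /= => rootE.
rewrite count_uniq_mem ?uniq_roots // -rootE.
by case: (boolP (root _ x)) => [|/mupNroot->]; rewrite ?mul1n ?muln0.
Qed.

(** * Cauchy-Schwarz and the Koolen-Moulton bound *)

Lemma sqr_sum_le (R : realDomainType) (s : seq R) :
  (\sum_(x <- s) x) ^+ 2 <= (size s)%:R * \sum_(x <- s) x ^+ 2.
Proof.
elim: s => [|x s IHs]; first by rewrite !big_nil mulr0 expr0n.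
rewrite !big_cons /= -natr1; set S := \sum_(_ <- _) _ in IHs *.
set Q := \sum_(_ <- _) _ in IHs *; set k : R := _%:R in IHs *.
(* This sum is exactly what the right side gains over the left when [x] is prepended. *)
have : 0 <= \sum_(y <- s) (x - y) ^+ 2 by apply: sumr_ge0 => *; rewrite sqr_ge0.
have -> : \sum_(y <- s) (x - y) ^+ 2 = k * x ^+ 2 - 2 * x * S + Q.
  rewrite /k /S /Q; elim: s {IHs S Q k} => [|y s IHs].
    by rewrite !big_nil /=; ring.
  by rewrite !big_cons IHs /= -natr1; ring.
by lra.
Qed.

Lemma sum_norm_eigenvalues_le (R : rcfType) n (A : 'M[R]_n) (l M : R) :
  A^T = A -> \tr A = 0 -> \tr (A *m A) <= M -> largest_eigenvalue A l ->
  \sum_(x <- eigenvalues A) `|x|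
    <= l + Num.sqrt ((n%:R - 1) * (M - l ^+ 2)).
Proof.
move=> symA trA trA2 [l_eig l_max].
have [r [cpE trE tr2E]] := symmetric_spectrum symA.
pose s := [seq r i | i : 'I_n].
have sE : char_poly A = \prod_(x <- s) ('X - x%:P).
  by rewrite cpE big_image.
have sP x : (x \in s) = eigenvalue A x.
  by rewrite eigenvalue_root_char sE root_prod_XsubC.
have ls : l \in s by rewrite sP.
(* Otherwise all eigenvalues would be negative, contradicting the zero trace. *)
have l_ge0 : 0 <= l.
  rewrite leNgt; apply/negP => l_lt0.
  suff : \sum_i r i < 0 by rewrite -trE trA ltxx.
  have [i _ _] := mapP ls.
  rewrite (bigD1 i) //= -[ltRHS]addr0; apply: ltr_leD.
    by apply: le_lt_trans l_lt0; apply: l_max; rewrite -sP image_f.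
  rewrite sumr_le0 // => j _; apply: le_trans (ltW l_lt0).
  by apply: l_max; rewrite -sP image_f.
have perms : perm_eq (eigenvalues A) (l :: rem l s).
  by rewrite (permPl (perm_eigenvalues sE)) perm_to_rem.
rewrite (perm_big _ perms) big_cons /= ger0_norm // lerD2l.
have size_s : size s = n by rewrite size_image card_ord.
have n_gt0 : (0 < n)%N by rewrite -size_s; case: (s) ls.
have szE : (size (rem l s))%:R = n%:R - 1 :> R.
  by rewrite size_rem // size_s -subn1 natrB.
have sum2 : \sum_(x <- rem l s) x ^+ 2 = \tr (A *m A) - l ^+ 2.
  have -> : \tr (A *m A) = \sum_(x <- s) x ^+ 2 by rewrite tr2E big_image.
  by rewrite (perm_big _ (perm_to_rem ls)) big_cons /=; ring.
have sumE : 0 <= \sum_(x <- rem l s) `|x| by apply: sumr_ge0.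
(* Writing the sum as the root of its square reduces the goal to comparing radicands, once the right
   one is known to be nonnegative. *)
rewrite -[leLHS]ger0_norm // -sqrtr_sqr.
have n1_ge0 : 0 <= n%:R - 1 :> R by rewrite -szE.
have lM : 0 <= M - l ^+ 2.
  apply: (le_trans _ (lerB trA2 (lexx _))); rewrite -sum2.
  by apply: sumr_ge0 => *; rewrite sqr_ge0.
rewrite ler_sqrt ?mulr_ge0 // -(big_map Num.norm xpredT id).
apply: le_trans (sqr_sum_le _) _; rewrite size_map szE ler_wpM2l // big_map.
under eq_bigr do rewrite real_normK ?num_real //.
by rewrite sum2 lerB.
Qed.

(** * Squared distances within one edge *)

Lemma sum_sqr_dist (R : numFieldType) (r : nat) :
  \sum_(i < r) \sum_(j < r) (i%:R - j%:R) ^+ 2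
    = 1 / 6 * (r%:R ^+ 2 * (r%:R ^+ 2 - 1)) :> R.
Proof.
have sum1 k : \sum_(j < k) j%:R = k%:R * (k%:R - 1) / 2 :> R.
  elim: k => [|k IHk]; first by rewrite big_ord0; field.
  by rewrite big_ord_recr IHk /= -natr1; field.
have sum2 k : \sum_(j < k) j%:R ^+ 2
    = k%:R * (k%:R - 1) * (2 * k%:R - 1) / 6 :> R.
  elim: k => [|k IHk]; first by rewrite big_ord0; field.
  by rewrite big_ord_recr IHk /= -natr1; field.
(* Expanding the square turns the double sum into [2 r] times the sum of squares minus twice the
   square of the sum. *)
under eq_bigr => i _.
  under eq_bigr do rewrite sqrrB -mulrnAr.
  rewrite big_split sumrB /= sumr_const card_ord -mulr_sumr sumrMnl.
  over.
rewrite big_split sumrB /= sumr_const card_ord !sumrMnl -mulr_suml sum1 sum2.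
by field.
Qed.

(** * Traces of the adjacency matrix and of its square *)

Section AdjacencyTrace.

Variables (R : rcfType) (n m : nat) (G : semigraph n m).
Implicit Types (e : 'I_m) (u v : 'I_n).

Lemma edge_dist_sym e u v : edge_dist G e u v = edge_dist G e v u.
Proof. exact: distnC. Qed.

Lemma sqr_edge_dist e u v :
  (edge_dist G e u v)%:R ^+ 2 = ((pos G e u)%:R - (pos G e v)%:R) ^+ 2 :> R.
Proof.
by rewrite natr_absz intr_norm real_normK ?num_real // rmorphB.
Qed.

Lemma end_vertex_size2 e v : size (G e) = 2 -> end_vertex G e v = (v \in G e).
Proof.
move=> s2; rewrite /end_vertex s2 /pos.
case: (boolP (v \in G e)) => //=; rewrite -index_mem s2.
by case: index => [|[]].
Qed.

(** Keeps the two corrections in [edge_weight] from applying together: a quarter edge has two middle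
    end vertices, a half edge on two vertices exactly one. *)
Lemma quarter_not_half e : quarter_edge G e -> ~~ half_edge G e.
Proof.
move=> /andP[/eqP s2 /forallP me]; rewrite /half_edge s2 /=.
suff -> : [set v | end_vertex G e v & middle_end_vertex G v] = [set v in G e].
  by rewrite cardsE (card_uniqP (edge_uniq G e)) s2.
apply/setP => v; rewrite !inE end_vertex_size2 //.
by have := me v; rewrite end_vertex_size2 //; case: (v \in G e).
Qed.

Lemma edge_dist_partial e u v :
  partial_half_edge G e u v -> edge_dist G e u v = 1.
Proof.
move=> /and4P[_ _ _]; rewrite /edge_dist; have := edge_size G e.
(* Sizes below 2 are excluded, so the truncated predecessors are the true positions [k] and
   [k.+1]. *)
case: (size _) => [|[|k]] // _ /orP[] /and3P[/eqP-> /eqP-> _] //=.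
by rewrite distnEr ?subSnn.
Qed.

Lemma edge_dist_quarter e u v : quarter_edge G e -> u != v ->
  u \in G e -> v \in G e -> edge_dist G e u v = 1.
Proof.
move=> /andP[/eqP s2 _] uv ue ve.
have : pos G e u != pos G e v.
  apply: contraNneq uv => /(congr1 (nth u (G e))).
  by rewrite !nth_index // => ->.
move: ue ve; rewrite -!index_mem s2 /edge_dist /pos.
by case: index => [|[|]] //; case: index => [|[|]].
Qed.

(* The share of the edge [e] in the square of the adjacency entry at [(u, v)]:
   1/4 on partial half edges, 1/16 on quarter edges and the squared distance
   elsewhere. *)
Definition edge_weight e u v : R :=
  (edge_dist G e u v)%:R ^+ 2
  - 15 / 16 * (quarter_edge G e && (u != v))%:R
  - 3 / 4 * (partial_half_edge G e u v || partial_half_edge G e v u)%:R.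

Lemma edge_weight_partial e u v :
  partial_half_edge G e u v || partial_half_edge G e v u ->
  edge_weight e u v = 1 / 4.
Proof.
move=> puv; rewrite /edge_weight puv.
have -> : edge_dist G e u v = 1.
  by case/orP: puv => /edge_dist_partial; rewrite // edge_dist_sym.
have /negPf-> : ~~ quarter_edge G e.
  apply: contraTN puv => /quarter_not_half/negPf nh.
  by rewrite /partial_half_edge nh.
by rewrite /=; field.
Qed.

Lemma edge_weight_quarter e u v : quarter_edge G e -> u != v ->
  u \in G e -> v \in G e -> edge_weight e u v = 1 / 16.
Proof.
move=> qe uv ue ve; rewrite /edge_weight qe uv edge_dist_quarter //.
by rewrite /partial_half_edge (negPf (quarter_not_half qe)) /=; field.
Qed.

(** Lets the weight of a single edge be bounded by a sum over all edges through [u] and [v]. *)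
Lemma edge_weight_ge0 e u v :
  u \in G e -> v \in G e -> 0 <= edge_weight e u v.
Proof.
move=> ue ve.
have [/edge_weight_partial->|np] :=
  boolP (partial_half_edge G e u v || partial_half_edge G e v u); first lra.
have [/andP[qe uv]|nq] := boolP (quarter_edge G e && (u != v)).
  by rewrite edge_weight_quarter //; lra.
by rewrite /edge_weight (negPf np) (negPf nq) !mulr0 !subr0 sqr_ge0.
Qed.

(** Each branch defining a nonzero entry exhibits an edge through [u] and [v] whose weight is the
    squared entry; the other weights only add to the sum. *)
Lemma sqr_adjacency_le u v :
  adjacency G R u v ^+ 2
    <= \sum_(e < m | (u \in G e) && (v \in G e)) edge_weight e u v.
Proof.
have le_sum e : u \in G e -> v \in G e ->
    edge_weight e u v
      <= \sum_(e < m | (u \in G e) && (v \in G e)) edge_weight e u v.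
  move=> ue ve; rewrite (bigD1 e) ?ue //= lerDl.
  by apply: sumr_ge0 => f /andP[/andP[uf vf] _]; apply: edge_weight_ge0.
rewrite mxE; case: ifPn => [/existsP[e puv]|/existsPn np].
  have [ue ve] : u \in G e /\ v \in G e by case/orP: puv => /and4P[].
  by apply: le_trans (le_sum e ue ve); rewrite edge_weight_partial //; lra.
case: ifPn => [/existsP[e /and4P[qe uv ue ve]]|/existsPn nq].
  by apply: le_trans (le_sum e ue ve); rewrite edge_weight_quarter //; lra.
(* Failure of the first two tests makes both corrections vanish on the picked edge. *)
case: pickP => [e /and3P[_ ue ve]|_].
  apply: le_trans (le_sum e ue ve); rewrite /edge_weight (negPf (np e)).
  by have := nq e; rewrite ue ve !andbT => /negPf->; rewrite !mulr0 !subr0.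
rewrite expr0n; apply: sumr_ge0 => f /andP[uf vf].
exact: edge_weight_ge0.
Qed.

Lemma adjacency_sym : (adjacency G R)^T = adjacency G R.
Proof.
apply/matrixP => u v; rewrite !mxE.
under eq_existsb do rewrite orbC.
case: ifP => // _.
under eq_existsb => e.
  rewrite eq_sym [X in _ && (_ && X)]andbC; over.
case: ifP => // _.
under eq_pick => e do rewrite [X in _ && X]andbC.
by case: pickP => // e _; rewrite edge_dist_sym.
Qed.

Lemma trace_adjacency : \tr (adjacency G R) = 0.
Proof.
apply: big1 => u _; rewrite mxE.
case: existsP => [[e]|_].
  (* A partial half edge [(u, u)] would have distance both 1 and 0. *)
  by rewrite orbb => /edge_dist_partial; rewrite /edge_dist distnn.
case: existsP => [[e]|_]; first by rewrite eqxx andbF.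
by case: pickP => // e _; rewrite /edge_dist distnn.
Qed.

Lemma big_edge (idx : R) (op : Monoid.com_law idx) (F : nat -> R) e :
  \big[op/idx]_(v in G e) F (pos G e v) = \big[op/idx]_(i < size (G e)) F i.
Proof.
(* Vertex 0 serves as the default value of [nth]. *)
rewrite -(big_uniq _ (edge_uniq G e)) (big_nth (Ordinal (ltnW (order_gt1 G)))).
rewrite big_mkord; apply: eq_bigr => i _.
by rewrite /pos index_uniq // edge_uniq.
Qed.

Lemma sum_edge_dist e :
  \sum_(u in G e) \sum_(v in G e) (edge_dist G e u v)%:R ^+ 2
    = 1 / 6 * ((size (G e))%:R ^+ 2 * ((size (G e))%:R ^+ 2 - 1)) :> R.
Proof.
rewrite -sum_sqr_dist.
under eq_bigr => u _.
  under eq_bigr do rewrite sqr_edge_dist.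
  rewrite (big_edge _ (fun j => ((pos G e u)%:R - j%:R) ^+ 2)).
  over.
by rewrite (big_edge _
  (fun i => \sum_(j < size (G e)) (i%:R - j%:R) ^+ 2)).
Qed.

(** The two ends form two ordered pairs, which turns the coefficient 15/16 into 15/8. *)
Lemma sum_quarter e :
  \sum_(u in G e) \sum_(v in G e) (quarter_edge G e && (u != v))%:R
    = 2 * (quarter_edge G e)%:R :> R.
Proof.
have [qe|_] := boolP (quarter_edge G e); last first.
  by rewrite mulr0; apply: big1 => u _; apply: big1.
have /andP[/eqP s2 _] := qe.
have cardG : #|G e| = 2 by rewrite (card_uniqP (edge_uniq G e)).
under eq_bigr => u ue.
  rewrite (eq_bigr (fun v => 1 - (v == u)%:R)); last first.
    by move=> v _; rewrite eq_sym; case: eqP; rewrite ?subrr ?subr0.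
  rewrite sumrB sumr_const cardG (bigD1 u) //= eqxx big1 ?addr0; last first.
    by move=> v /andP[_ /negPf->].
  over.
by rewrite sumr_const cardG /=; ring.
Qed.

(** The sum meets every partial half edge in both orders; keeping one order is enough for the
    coefficients 3/4 and 1/2. *)
Lemma sum_partial_half_edge_ge e :
  (num_partial_half_edges G e)%:R
    <= \sum_(u in G e) \sum_(v in G e)
         (partial_half_edge G e u v || partial_half_edge G e v u)%:R :> R.
Proof.
under eq_bigr do rewrite -natr_sum.
rewrite -natr_sum ler_nat /num_partial_half_edges -sum1dep_card.
rewrite -(pair_big_dep xpredT (partial_half_edge G e) (fun _ _ => 1%N)) /=.
rewrite [leqRHS]big_mkcond; apply: leq_sum => u _.
have [ue|nu] := boolP (u \in G e); last first.
  by rewrite big_pred0 // => v; rewrite /partial_half_edge (negPf nu) andbF.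
rewrite big_mkcond [leqRHS]big_mkcond; apply: leq_sum => v _.
have [ve|nv] := boolP (v \in G e); last first.
  by rewrite /partial_half_edge (negPf nv) !andbF.
by case: partial_half_edge.
Qed.

Lemma sum_edge_weight_le e :
  \sum_(u in G e) \sum_(v in G e) edge_weight e u v
    <= 1 / 6 * ((size (G e))%:R ^+ 2 * ((size (G e))%:R ^+ 2 - 1))
       - 15 / 8 * (quarter_edge G e)%:R
       - 3 / 4 * (half_edge G e && (num_partial_half_edges G e == 1))%:R
       - 1 / 2 * (half_edge G e && (num_partial_half_edges G e == 2))%:R.
Proof.
rewrite /edge_weight.
under eq_bigr do rewrite !sumrB -!mulr_sumr.
rewrite !sumrB -!mulr_sumr sum_edge_dist sum_quarter.
have := sum_partial_half_edge_ge e; set S := \sum_(u in _) _.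
(* The correction [3 / 4 * S] is at least 3/4 for one partial half edge and 3/2 for two; beyond two
   both indicators vanish and [0 <= S] suffices. *)
case: half_edge; case: num_partial_half_edges => [|[|[|k]]] /= pge; try lra.
all: have : 0 <= k.+3%:R :> R by [].
all: lra.
Qed.

(** By symmetry the trace is the sum of the squared entries; exchanging sums regroups their bounds
    edge by edge. *)
Lemma trace_sqr_adjacency_le :
  \tr (adjacency G R *m adjacency G R)
    <= 1 / 6 * (\sum_(e < m) (size (G e))%:R ^+ 2 * ((size (G e))%:R ^+ 2 - 1))
       - 15 / 8 * (num_quarter_edges G)%:R
       - 3 / 4 * (num_half_edges_with G 1)%:R
       - 1 / 2 * (num_half_edges_with G 2)%:R.
Proof.
have cardE (P : pred 'I_m) : #|[set e | P e]|%:R = \sum_e (P e)%:R :> R.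
  rewrite -sum1dep_card natr_sum big_mkcond.
  by apply: eq_bigr => e _; case: (P e).
rewrite /num_quarter_edges /num_half_edges_with !cardE !mulr_sumr -!sumrB.
apply: le_trans (ler_sum _ (fun e _ => sum_edge_weight_le e)).
under [leRHS]eq_bigr do rewrite big_mkcond.
rewrite exchange_big; apply: ler_sum => u _.
rewrite mxE (eq_bigr (fun v => adjacency G R u v ^+ 2)); last first.
  by move=> v _; rewrite expr2 -[in X in _ * X]adjacency_sym [X in _ * X]mxE.
apply: le_trans (ler_sum _ (fun v _ => sqr_adjacency_le u v)) _.
rewrite (exchange_big_dep (fun e => u \in G e)) /=; last first.
  by move=> v e _ /andP[].
rewrite [leLHS]big_mkcond; apply: ler_sum => e _.
by case: (boolP (u \in G e)).
Qed.

End AdjacencyTrace.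

Theorem theorem4 (R : realType) (n m : nat) (G : semigraph n m) (lambda1 : R) :
  semigraph_connected G ->
  largest_eigenvalue (adjacency G R) lambda1 ->
  energy R G <=
    lambda1 + Num.sqrt ((n%:R - 1) *
      (1 / 6 * (\sum_(e < m) (size (G e))%:R ^+ 2 * ((size (G e))%:R ^+ 2 - 1))
       - 15 / 8 * (num_quarter_edges G)%:R
       - 3 / 4 * (num_half_edges_with G 1)%:R
       - 1 / 2 * (num_half_edges_with G 2)%:R
       - lambda1 ^+ 2)).
Proof.
move=> _; apply: sum_norm_eigenvalues_le; first exact: adjacency_sym.
- exact: trace_adjacency.
- exact: trace_sqr_adjacency_le.
Qed.
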